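(* Let $G$ be a completely metrizable topological group with identity $e$, let $d$ be a left-invariant compatible metric on $G$, and let $T\colon G\to G$ be a continuous endomorphism of $G$. Then the following assertions are equivalent: (1) $T$ admits a distributionally semi-irregular point of type $2$; (2) $T$ admits a distributionally chaotic pair of type $2$; (3) $T$ is distributionally chaotic of type $2$; (4) the restriction of $T$ to some closed $T$-invariant subgroup $\widetilde{G}$ of $G$ has a dense (in $\widetilde G$) set of distributionally semi-irregular points of type $2$.
   Context: A topological group is completely metrizable if its topology is induced by some complete metric. A compatible metric $d$ on $G$ is a metric inducing the topology of $G$ (not required to be complete); it is left-invariant if $d(zx,zy)=d(x,y)$ for all $x,y,z\in G$. A continuous endomorphism is a continuous group homomorphism $G\to G$. A subset $Y\subset G$ is $T$-invariant if $TY\subset Y$. $\mathbb{N}$ is the set of positive integers. For $A\subset\mathbb{N}$, $\overline{\mathrm{dens}}(A)=\limsup_{n\to\infty}\frac{\mathrm{card}(A\cap[1,n])}{n}$. A point $x\in G$ is distributionally semi-irregular of type $2$ for $T$ if there exists $A\subset\mathbb{N}$ with $\overline{\mathrm{dens}}(A)=1$ such that $\lim_{A\ni n\to\infty}T^nx=e$ and there exists $B\subset\mathbb{N}$ with $\overline{\mathrm{dens}}(B)>0$ such that $\liminf_{B\ni n\to\infty}d(T^nx,e)>0$. A pair $(x,y)\in G\times G$ is distributionally proximal if for every $\varepsilon>0$, $\overline{\mathrm{dens}}(\{n\in\mathbb{N}:d(T^nx,T^ny)<\varepsilon\})=1$. For $\delta>0$, a pair $(x,y)$ is distributionally $\delta$-chaotic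 of type $2$ if it is distributionally proximal and $\overline{\mathrm{dens}}(\{n\in\mathbb{N}:d(T^nx,T^ny)>\delta\})\ge\delta$. A distributionally chaotic pair of type $2$ is a pair that is distributionally $\delta$-chaotic of type $2$ for some $\delta>0$. $T$ is distributionally chaotic of type $2$ if there exists an uncountable set $K\subset G$ such that any two distinct points $x,y\in K$ form a distributionally $\delta$-chaotic pair of type $2$ for some $\delta=\delta(x,y)>0$. *)

(* Defs.v *)
From HB Require Import structures.
From mathcomp Require Import all_boot all_order all_algebra.
From mathcomp Require Import all_classical all_reals all_analysis.

Set Implicit Arguments.
Unset Strict Implicit.
Unset Printing Implicit Defensive.

Import Order.TTheory GRing.Theory Num.Theory.
Import numFieldTopology.Exports.

Local Open Scope classical_set_scope.
Local Open Scope ring_scope.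

(* The multiplicative, possibly non-commutative analogue of
   [topologicalZmodType]. *)
HB.mixin Record isTopologicalGroup G & Topological G & Group G := {
  mulg_continuous : continuous (fun p : G * G => (p.1 * p.2)%g) ;
  invg_continuous : continuous (fun x : G => (x^-1)%g)
}.

#[short(type="topologicalGroupType")]
HB.structure Definition TopologicalGroup :=
  {G of Topological G & Group G & isTopologicalGroup G}.

Section metrics.
Context {R : realType}.

Definition is_metric {X : Type} (d : X -> X -> R) : Prop :=
  [/\ forall x y, d x y = 0 <-> x = y,
      forall x y, d x y = d y x &
      forall x y z, d x z <= d x y + d y z].

Definition compatible_metric {X : topologicalType} (d : X -> X -> R) : Prop :=
  is_metric d /\
  forall (x : X) (U : set X),
    nbhs x U <-> exists2 e : R, 0 < e & [set y | d x y < e] `<=` U.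

(* Convergence is in the topology of [X]; this is only used for metrics that
   are compatible with that topology. *)
Definition complete_metric {X : topologicalType} (d : X -> X -> R) : Prop :=
  forall u : nat -> X,
    (forall e : R, 0 < e -> exists N : nat,
       forall m n : nat, (N <= m)%N -> (N <= n)%N -> d (u m) (u n) < e) ->
    exists l : X, u @ \oo --> l.

Definition left_invariant {G : groupType} (d : G -> G -> R) : Prop :=
  forall x y z : G, d (z * x)%g (z * y)%g = d x y.

End metrics.

Definition completely_metrizable (R : realType) (X : topologicalType) : Prop :=
  exists d : X -> X -> R, compatible_metric d /\ complete_metric d.

(* Sets of positive integers are represented by [set nat]: only the elements
   in [1, n] are counted, so whether 0 belongs to [A] is irrelevant, as it is
   for limits along [A]. *)
Definition upper_density (R : realType) (A : set nat) : \bar R :=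
  limn_esup (fun n : nat =>
    ((\sum_(1 <= k < n.+1 | k \in A) 1)%N%:R / n%:R : R)%:E).

Section distributional_chaos.
Context {R : realType} {X : topologicalType}.
Variables (d : X -> X -> R) (T : X -> X).

(* The limit inferior is taken in the extended reals, as [d] may be
   unbounded. *)
Definition dist_semi_irregular2 (e x : X) : Prop :=
  (exists A : set nat, upper_density R A = 1%E /\
     iter n T x @[n --> within A \oo] --> e) /\
  (exists B : set nat, (0 < upper_density R B)%E /\
     (0 < limf_einf (fun n : nat => (d (iter n T x) e)%:E)
            (within B \oo))%E).

Definition dist_proximal (x y : X) : Prop :=
  forall eps : R, 0 < eps ->
    upper_density R [set n | d (iter n T x) (iter n T y) < eps] = 1%E.

Definition dist_delta_chaotic_pair2 (delta : R) (x y : X) : Prop :=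
  dist_proximal x y /\
  (delta%:E <=
   upper_density R [set n | (delta < d (iter n T x) (iter n T y))%R])%E.

Definition dist_chaotic_pair2 (x y : X) : Prop :=
  exists2 delta : R, 0 < delta & dist_delta_chaotic_pair2 delta x y.

Definition dist_chaotic2 : Prop :=
  exists K : set X, ~ countable K /\
    forall x y : X, K x -> K y -> x <> y -> dist_chaotic_pair2 x y.

End distributional_chaos.

Definition is_subgroup {G : groupType} (H : set G) : Prop :=
  [/\ H 1%g, forall x y, H x -> H y -> H (x * y)%g
    & forall x, H x -> H (x^-1)%g].

Lemma subgroup_one {G : groupType} (H : set G) : is_subgroup H -> H 1%g.
Proof. by case. Qed.

Definition invariant_set {X : Type} (T : X -> X) (H : set X) : Prop :=
  T @` H `<=` H.

Section restriction.
Context {G : groupType} (H : set G).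

Definition sub_one (sH : is_subgroup H) : H :=
  SigSub (mem_set (subgroup_one sH)).

Definition restrict_map (T : G -> G) (TH : invariant_set T H) (x : H) : H :=
  SigSub (mem_set (TH _ (imageP T (set_valP x)))).

Definition restrict_metric {R : realType} (d : G -> G -> R) (x y : H) : R :=
  d (set_val x) (set_val y).

End restriction.

(* Main.v *)
Require Import Defs.
From HB Require Import structures.
From mathcomp Require Import all_boot all_order all_algebra.
From mathcomp Require Import all_classical all_reals all_analysis.
From mathcomp Require Import lra zify.

Import Order.TTheory GRing.Theory Num.Theory.
Import numFieldTopology.Exports.

Local Open Scope classical_set_scope.
Local Open Scope ring_scope.

Set Implicit Arguments.
Unset Strict Implicit.

(** Call [x] a chaotic point for [delta] if [T^n x] comes within every
    [eps > 0] of the identity for a set of [n] of upper density one, while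
    [d (T^n x) 1 > delta] for a set of [n] of upper density at least [delta].

    The first condition is the diagonal form of convergence along a set of
    upper density one, so semi-irregular points are exactly the points that
    are chaotic for some [delta > 0] ([dist_semi_irregular2P]).  Left
    invariance turns [d (T^n x) (T^n y)] into [d (T^n (x^-1 y)) 1], so a pair
    [(x, y)] is chaotic if and only if the point [x^-1 y] is
    ([dist_delta_chaotic_pair2E]).  This gives the equivalence of (1) and (2),
    and (3) implies (2) since an uncountable set has two distinct points.

    Fix a chaotic point [u] and let [L] be the subgroup generated by the orbit
    of [u].  A single sequence of times [N j] witnesses the upper density one
    for [u] at every scale.  The sets of integers of relative density one along
    [N j] form a filter that is invariant under shifts, and [T^n u] tends to
    the identity along it.  Limits along a filter are compatible with products,
    so [T^n x] tends to the identity along it for every [x] in [L]: although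
    upper density one is not stable under intersection, all points of [L] are
    proximal to the identity simultaneously ([orbit_group_dist_cvg]).
    For [x] in [L] and [m] with [T^m u] close to the identity, the triangle
    inequality shows that [T^n x] or [T^n (x T^m u)] is far from the identity
    whenever [T^(n + m) u] is; hence [x] or [x T^m u] is chaotic for
    [delta / 2].  So chaotic points are dense in the closure [H] of [L]
    ([orbit_group_chaotic_dense]), which is (4), and (4) implies (1) because
    the restricted system has the same distances to the identity.

    For (3), chaotic points for [delta / 2] form a countable intersection of
    open sets ([chaotic_pointP]), which is dense in [H].  Take a maximal subset
    [K] of [H] whose distinct points have chaotic quotients.  If [K] were
    countable, the Baire category theorem in [H] would provide [y] with
    [k^-1 y] chaotic for all [k] in [K], and [y] could be added to [K]. *)

(** * Upper density *)

Section upper_density_theory.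
Variable R : realType.
Implicit Types (A B : set nat) (m n N : nat) (c e : R).

Definition count_upto A n := (\sum_(1 <= k < n.+1 | k \in A) 1)%N.

Lemma count_upto0 A : count_upto A 0 = 0%N.
Proof. by rewrite /count_upto big_geq. Qed.

Lemma count_uptoS A n : count_upto A n.+1 = (count_upto A n + (n.+1 \in A))%N.
Proof.
rewrite /count_upto big_mkcond big_nat_recr //= -big_mkcond.
by case: (_ \in A).
Qed.

Lemma count_upto_pred A n :
  count_upto A n.+1 = ((1%N \in A) + count_upto [set k | A k.+1] n)%N.
Proof.
elim: n => [|n IH]; first by rewrite count_uptoS !count_upto0 addnC.
by rewrite count_uptoS IH count_uptoS addnA.
Qed.

Lemma sub_count_upto A B n : (forall k, (0 < k <= n)%N -> A k -> B k) ->
  (count_upto A n <= count_upto B n)%N.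
Proof.
elim: n => [|n IH] AB; first by rewrite !count_upto0.
rewrite !count_uptoS leq_add//.
  by apply: IH => k /andP[k0 kn]; apply: AB; rewrite k0 leqW.
case: (boolP (n.+1 \in A)) => //= /set_mem/AB; rewrite leqnn => /(_ isT) Bn.
by rewrite mem_set.
Qed.

Lemma count_upto_le A n : (count_upto A n <= n)%N.
Proof.
elim: n => [|n IH]; first by rewrite count_upto0.
by rewrite count_uptoS -addn1 leq_add// leq_b1.
Qed.

Lemma count_upto_set0 n : count_upto set0 n = 0%N.
Proof.
by elim: n => [|n IH]; rewrite ?count_upto0// count_uptoS IH in_set0.
Qed.

Lemma count_uptoU A B n :
  (count_upto (A `|` B) n <= count_upto A n + count_upto B n)%N.
Proof.
elim: n => [|n IH]; first by rewrite !count_upto0.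
by rewrite !count_uptoS addnACA leq_add// in_setU; do 2 case: (_ \in _).
Qed.

Lemma count_uptoC A n : (count_upto A n + count_upto (~` A) n)%N = n.
Proof.
elim: n => [|n IH]; first by rewrite !count_upto0.
by rewrite !count_uptoS addnACA IH in_setC; case: (_ \in _); rewrite addn1.
Qed.

Lemma count_upto_shift A m n :
  (count_upto A n <= count_upto [set k | A (k + m)%N] n + m)%N /\
  (count_upto [set k | A (k + m)%N] n <= count_upto A n + m)%N.
Proof.
elim: m => [|m [IH1 IH2]].
  by split; rewrite addn0; apply: sub_count_upto => k _ /=; rewrite addn0.
have -> : [set k | A (k + m.+1)%N] = [set k | [set k | A (k + m)%N] k.+1].
  by apply/funext => k /=; rewrite addnS addSn.
set B := [set k | A (k + m)%N] in IH1 IH2 *.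
have := count_upto_pred B n; rewrite count_uptoS => H.
have b1 := leq_b1 (1%N \in B); have b2 := leq_b1 (n.+1 \in B).
by split; lia.
Qed.

(** The form in which upper densities are used throughout: the frequencies
    exceed every [c - e] at arbitrarily late times.  Clearing the denominator
    makes the time [n = 0], where both sides vanish, harmless. *)
Lemma upper_density_geP A c : (c%:E <= upper_density R A)%E <->
  forall e, 0 < e -> forall N, exists2 n, (N <= n)%N &
    (c - e) * n%:R < (count_upto A n)%:R.
Proof.
rewrite /upper_density /limn_esup limf_esupE; split.
  move=> cA e e0 N; apply: contrapT => noN.
  suff /(le_trans cA) : (ereal_inf [set ereal_sup ((fun n =>
    ((count_upto A n)%:R / n%:R : R)%:E) @` V) | V in \oo] <= (c - e)%:E)%E.
    by rewrite lee_fin lerBrDr gerDl leNgt e0.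
  apply: le_trans (ereal_inf_lbound _) _.
    by exists [set n | (N.+1 <= n)%N]; first by exists N.+1.
  apply: ge_ereal_sup => _ /= [n Nn <-]; rewrite lee_fin.
  rewrite ler_pdivrMr ?ltr0n ?(leq_trans _ Nn)// leNgt; apply/negP => H.
  by apply: noN; exists n => //; exact: ltnW.
move=> H; apply: le_ereal_inf_tmp => _ /= [V [N _ NV] <-].
apply/lee_addgt0Pr => e e0; have [n Nn cn] := H e e0 N.
have n0 : 0 < n%:R :> R.
  by case: n cn {Nn} => [|n _]; rewrite ?ltr0n// mulr0 count_upto0 ltxx.
rewrite -leeBlDr// -EFinB; apply: le_trans (ereal_sup_ubound _); last first.
  by exists n => //; exact: NV.
by rewrite lee_fin ler_pdivlMr// ltW.
Qed.

Lemma upper_density_le1 A : (upper_density R A <= 1)%E.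
Proof.
rewrite /upper_density /limn_esup limf_esupE.
apply: le_trans (ereal_inf_lbound _) _.
  by exists setT; first exact: filterT.
apply: ge_ereal_sup => _ /= [n _ <-]; rewrite lee_fin -/(count_upto A n).
case: n => [|n]; first by rewrite invr0 mulr0.
by rewrite ler_pdivrMr ?ltr0n// mul1r ler_nat count_upto_le.
Qed.

Lemma upper_density1P A : upper_density R A = 1%E <->
  forall e, 0 < e -> forall N, exists2 n, (N <= n)%N &
    (1 - e) * n%:R < (count_upto A n)%:R.
Proof.
rewrite -upper_density_geP; split=> [->//|A1].
by apply/eqP; rewrite eq_le upper_density_le1.
Qed.

(** A bounded error in the counting function is negligible against [n]; this
    covers both shifts and changes on finitely many integers. *)
Lemma upper_density_ge_count A B c m :
  (forall n, (count_upto A n <= count_upto B n + m)%N) ->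
  (c%:E <= upper_density R A)%E -> (c%:E <= upper_density R B)%E.
Proof.
move=> AB /upper_density_geP cA; apply/upper_density_geP => e e0 N.
have e20 : 0 < e / 2 by rewrite divr_gt0.
have [n] := cA _ e20 (maxn N (Num.truncn (m%:R / (e / 2))).+1).
rewrite geq_max => /andP[Nn mn] cn; exists n => //.
have mlt : m%:R < n%:R * (e / 2) :> R.
  rewrite -ltr_pdivrMr//; apply: lt_le_trans (truncnS_gt _) _.
  by rewrite ler_nat.
have : (count_upto A n)%:R <= (count_upto B n)%:R + m%:R :> R.
  by rewrite -natrD ler_nat.
by move: cn mlt; clear; nra.
Qed.

Lemma upper_density_ge_eventually A B c N :
  (forall n, (N <= n)%N -> A n -> B n) ->
  (c%:E <= upper_density R A)%E -> (c%:E <= upper_density R B)%E.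
Proof.
move=> AB; apply: (@upper_density_ge_count _ _ _ (N + N)) => n.
have [+ _] := count_upto_shift A N n; have [_ +] := count_upto_shift B N n.
have : (count_upto [set k | A (k + N)%N] n <=
        count_upto [set k | B (k + N)%N] n)%N.
  by apply: sub_count_upto => k _; apply: AB; rewrite leq_addl.
lia.
Qed.

Lemma upper_density_ge_shift A c m : (c%:E <= upper_density R A)%E ->
  (c%:E <= upper_density R [set k | A (k + m)%N])%E.
Proof.
by apply: (@upper_density_ge_count _ _ _ m) => n; case: (count_upto_shift A m n).
Qed.

(** Upper density is subadditive: an upper bound on an upper density holds at
    all late times, hence for two sets at once. *)
Lemma upper_density_ge_half A B C c : C `<=` A `|` B ->
  (c%:E <= upper_density R C)%E ->
  ((c / 2)%:E <= upper_density R A)%E \/ ((c / 2)%:E <= upper_density R B)%E.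
Proof.
move=> CAB /upper_density_geP cC.
have far D : ~ ((c / 2)%:E <= upper_density R D)%E ->
    exists e N, 0 < e /\ forall n, (N <= n)%N ->
      (count_upto D n)%:R <= (c / 2 - e) * n%:R.
  move=> /upper_density_geP/existsNP[e]/not_implyP[e0 /existsNP[N H]].
  exists e, N; split => // n Nn; rewrite leNgt; apply/negP => cn.
  by apply: H; exists n.
apply: contrapT => /not_orP[/far[e1 [N1 [e10 A1]]] /far[e2 [N2 [e20 B2]]]].
have [n] := cC _ (addr_gt0 e10 e20) (maxn N1 N2).
rewrite geq_max => /andP[/A1 An /B2 Bn].
apply/negP; rewrite -leNgt.
have : (count_upto C n)%:R <= (count_upto A n)%:R + (count_upto B n)%:R :> R.
  rewrite -natrD ler_nat (leq_trans _ (count_uptoU _ _ _))//.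
  by apply: sub_count_upto => k _; exact: CAB.
by move: An Bn; clear; nra.
Qed.

Lemma upper_density_gt0_nonempty A c : 0 < c ->
  (c%:E <= upper_density R A)%E -> A !=set0.
Proof.
move=> c0 /upper_density_geP cA.
have [n _] := cA _ c0 0%N; rewrite subrr mul0r ltr0n => An.
apply/set0P/eqP => A0; move: An.
by rewrite A0 count_upto_set0.
Qed.
End upper_density_theory.

(** * Convergence along sets of upper density one *)

Section density_filter.
Variable R : realType.
Implicit Types (N : nat -> nat) (S A : set nat) (E : nat -> set nat).

(** The sets of relative density one along the times [N j].  Upper density one
    alone does not define a filter; fixing the times does. *)
Definition density_filter N : set_system nat :=
  [set S | forall e : R, 0 < e ->
    \forall j \near \oo, (count_upto (~` S) (N j))%:R <= e * (N j)%:R].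

#[local] Instance density_filter_filter N : Filter (density_filter N).
Proof.
split=> [e e0|S1 S2 F1 F2 e e0|S1 S2 S12 F1 e e0].
- exists 0%N => //= j _; rewrite setCT count_upto_set0.
  by rewrite mulr_ge0 ?ler0n// ltW.
- have e20 : 0 < e / 2 by rewrite divr_gt0.
  apply: filterS2 (F1 _ e20) (F2 _ e20) => j c1 c2; rewrite setCI.
  rewrite (le_trans (_ : _ <= (count_upto (~` S1) (N j) +
    count_upto (~` S2) (N j))%:R))//; first by rewrite ler_nat count_uptoU.
  by rewrite natrD (splitr e) mulrDl lerD.
- apply: filterS (F1 _ e0) => j; apply: le_trans.
  by rewrite ler_nat; apply: sub_count_upto => k _; apply: contra_not; exact: S12.
Qed.

Lemma density_filter_density1 N S : (forall j, (j <= N j)%N) ->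
  density_filter N S -> upper_density R S = 1%E.
Proof.
move=> jN FS; apply/upper_density1P => e e0 M.
have e20 : 0 < e / 2 by rewrite divr_gt0.
have [J _ HJ] := FS _ e20.
pose j := maxn J M.+1; have Mj : (M < N j)%N.
  by rewrite (leq_trans _ (jN j))// leq_maxr.
exists (N j); first exact: ltnW.
have := HJ j (leq_maxl _ _).
have : 0 < (N j)%:R :> R by rewrite ltr0n (leq_ltn_trans _ Mj).
have := count_uptoC S (N j) => /(congr1 (fun n => n%:R : R)); rewrite natrD.
by move: e0; clear; nra.
Qed.

(** Shifting by [m] changes at most [m] elements up to time [N j], and
    [m / N j] tends to zero. *)
Lemma density_filter_shift N S m : (forall j, (j <= N j)%N) ->
  density_filter N S -> density_filter N [set k | S (k + m)%N].
Proof.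
move=> jN FS e e0; have e20 : 0 < e / 2 by rewrite divr_gt0.
have := FS _ e20; apply: filter_app.
exists (Num.truncn (m%:R / (e / 2))).+1 => //= j mj cj.
have mlt : m%:R < (N j)%:R * (e / 2) :> R.
  rewrite -ltr_pdivrMr//; apply: lt_le_trans (truncnS_gt _) _.
  by rewrite ler_nat (leq_trans mj).
have : (count_upto (~` [set k | S (k + m)%N]) (N j))%:R
    <= (count_upto (~` S) (N j))%:R + m%:R :> R.
  by rewrite -natrD ler_nat; case: (count_upto_shift (~` S) m (N j)).
by move: cj mlt; clear; nra.
Qed.

(** Each [E j] is used at one time only, with an error [1 / (j + 1)], and
    these times can be chosen one after the other. *)
Lemma density1_scale E : (forall j, upper_density R (E j) = 1%E) ->
  exists N, (forall j, (N j < N j.+1)%N) /\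
    forall j, (count_upto (~` E j) (N j))%:R <= j.+1%:R^-1 * (N j)%:R :> R.
Proof.
move=> E1.
have /choice[f Hf] : forall p : nat * nat, exists n, (p.2 <= n)%N /\
    (count_upto (~` E p.1) n)%:R <= p.1.+1%:R^-1 * n%:R :> R.
  move=> [j M] /=; have /upper_density1P := E1 j.
  have j0 : 0 < j.+1%:R^-1 :> R by rewrite invr_gt0 ltr0n.
  move=> /(_ _ j0 M)[n Mn cn]; exists n; split => //.
  have := count_uptoC (E j) n => /(congr1 (fun n => n%:R : R)); rewrite natrD.
  by move: cn; move: (j.+1%:R^-1) => t; clear; nra.
pose fix N j := if j is i.+1 then f (j, (N i).+1) else f (0%N, 0%N).
exists N; split=> [j|[|j]].
- exact: (Hf (j.+1, (N j).+1)).1.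
- exact: (Hf (0%N, 0%N)).2.
- exact: (Hf (j.+1, (N j).+1)).2.
Qed.

(** A set that agrees with the [E j] only up to time [N j] already has
    relative density one, since nothing later than [N j] is counted there. *)
Lemma density_filter_scale N E S J : (forall j, (J <= j)%N ->
    forall n, (n <= N j)%N -> E j n -> S n) ->
  (forall j, (count_upto (~` E j) (N j))%:R <= j.+1%:R^-1 * (N j)%:R :> R) ->
  density_filter N S.
Proof.
move=> ES cE e e0; exists (maxn J (Num.truncn e^-1)) => // j.
rewrite /mkset geq_max => /andP[Jj ej].
apply: le_trans (_ : (count_upto (~` E j) (N j))%:R <= _).
  rewrite ler_nat; apply: sub_count_upto => k /andP[_ kN]; apply: contra_not.
  exact: ES.
apply: le_trans (cE j) _; rewrite ler_wpM2r ?ler0n//.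
rewrite invf_ple ?posrE ?ltr0n//.
by apply/ltW; apply: lt_le_trans (truncnS_gt _) _; rewrite ler_nat.
Qed.
End density_filter.

Section metric_topology.
Context {R : realType} {X : topologicalType}.
Variable d : X -> X -> R.
Hypothesis dcompat : compatible_metric d.

Lemma cmetric_xx x : d x x = 0.
Proof. by have [[/(_ x x)[_ ->//] _ _] _] := dcompat. Qed.

Lemma cmetric_sym x y : d x y = d y x.
Proof. by have [[_ ]] := dcompat. Qed.

Lemma cmetric_triangle y x z : d x z <= d x y + d y z.
Proof. by have [[_ _]] := dcompat. Qed.

Lemma nbhs_metric_ball x e : 0 < e -> nbhs x [set y | d y x < e].
Proof.
move=> e0; apply/(dcompat.2 x); exists e => // y /=.
by rewrite cmetric_sym.
Qed.

Lemma nbhs_metricP x (U : set X) :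
  nbhs x U -> exists2 e, 0 < e & forall y, d y x < e -> U y.
Proof.
move=> /(dcompat.2 x)[e e0 eU]; exists e => // y yx.
by apply: eU => /=; rewrite cmetric_sym.
Qed.

Lemma open_metric_lt l e : open [set y | d y l < e].
Proof.
rewrite openE => x /= xe; rewrite /interior.
have := @nbhs_metric_ball x (e - d x l).
rewrite subr_gt0 => /(_ xe); apply: filterS => y /=.
by have := cmetric_triangle x y l; lra.
Qed.

Lemma open_metric_gt l e : open [set y | e < d y l].
Proof.
rewrite openE => x /= xe; rewrite /interior.
have := @nbhs_metric_ball x (d x l - e).
rewrite subr_gt0 => /(_ xe); apply: filterS => y /=.
by have := cmetric_triangle y x l; rewrite (cmetric_sym x y); lra.
Qed.

Definition dist_cvg (a : nat -> X) (l : X) := forall e, 0 < e ->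
  upper_density R [set n | d (a n) l < e] = 1%E.

Lemma density_filter_dist_cvg N a l : (forall j, (j <= N j)%N) ->
  a @ density_filter R N --> l -> dist_cvg a l.
Proof.
move=> jN al e e0; apply: (density_filter_density1 jN).
exact: (al _ (nbhs_metric_ball l e0)).
Qed.

(** Let [N j] be a time up to which [a] is [1 / (j + 1)]-close to [l] outside
    a fraction [1 / (j + 1)] of the integers.  The sequence converges along the
    density filter of [N].  It also converges along the set of all [n] at which
    [a] is [1 / (j + 1)]-close to [l] for every [j] with [N j < n]: up to the
    time [N j] this requires no more than being [1 / (j + 1)]-close, so the set
    has upper density one. *)
Lemma dist_cvg_realized a l : dist_cvg a l ->
  exists N, [/\ forall j, (j <= N j)%N,
  a @ density_filter R N --> l &
  exists A, upper_density R A = 1%E /\ a n @[n --> within A \oo] --> l].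
Proof.
move=> al; pose E j := [set n | d (a n) l < j.+1%:R^-1].
have inv0 j : 0 < j.+1%:R^-1 :> R by rewrite invr_gt0 ltr0n.
have [N [incrN cN]] := @density1_scale R E (fun j => al _ (inv0 j)).
have jN j : (j <= N j)%N.
  by elim: j => // j IH; exact: leq_ltn_trans IH (incrN j).
have monoN : {homo N : i j / (i <= j)%N}.
  by apply: homo_leq => // [i j k|i]; [exact: leq_trans|exact: ltnW].
have E_small e : 0 < e ->
    forall j n, (Num.truncn e^-1 <= j)%N -> E j n -> d (a n) l < e.
  move=> e0 j n ej /lt_le_trans; apply; rewrite invf_ple ?posrE ?ltr0n//.
  by apply/ltW; apply: lt_le_trans (truncnS_gt _) _; rewrite ler_nat.
exists N; split => //.
  move=> U /nbhs_metricP[e e0 eU].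
  apply: (density_filter_scale (J := Num.truncn e^-1) _ cN) => j ej n _ En.
  exact/eU/(E_small _ e0 _ _ ej).
exists [set n | forall j, (N j < n)%N -> E j n]; split.
  apply: (density_filter_density1 jN).
  apply: (density_filter_scale (J := 0) _ cN) => j _ n nj Ejn i iN /=.
  have ij : (i <= j)%N.
    by rewrite leqNgt; apply/negP => /ltnW/monoN ji; lia.
  apply: lt_le_trans Ejn _; rewrite lef_pV2 ?posrE ?ltr0n// ler_nat.
  by rewrite ltnS.
move=> U /nbhs_metricP[e e0 eU].
exists (N (Num.truncn e^-1)).+1 => //= n Nn An.
exact/eU/(E_small _ e0 (Num.truncn e^-1))/An.
Qed.

End metric_topology.

(** * Chaotic points and semi-irregular points *)

Section semi_irregular_points.
Context {R : realType} {X : topologicalType}.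
Variables (d : X -> X -> R) (T : X -> X) (x0 : X).
Hypothesis dcompat : compatible_metric d.

Lemma limf_einf_gt0 (f : nat -> R) (F : set_system nat) :
  (0 < limf_einf (EFin \o f) F)%E <->
  exists2 s, 0 < s & exists2 V : set nat, F V & forall n, V n -> s <= f n.
Proof.
rewrite /limf_einf limf_esupE oppe_gt0; split.
  move=> /ereal_inf_lt[_ [V FV <-]] supV.
  have [s s0 supVs] : exists2 s, 0 < s &
      (ereal_sup ((\- (EFin \o f))%E @` V) <= (- s)%:E)%E.
    move: supV; case: (ereal_sup _) => [r| |].
    - by rewrite lte_fin => r0; exists (- r); rewrite ?oppr_gt0// opprK.
    - by rewrite ltNge leey.
    - by exists 1; rewrite ?leNye.
  exists s => //; exists V => // n Vn.
  have : ((- f n)%:E <= (- s)%:E)%E.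
    by apply: le_trans supVs; apply: ereal_sup_ubound; exists n.
  by rewrite lee_fin lerN2.
move=> [s s0 [V FV sf]]; apply: (@le_lt_trans _ _ (- s)%:E).
  apply: le_trans (ereal_inf_lbound _) _; first by exists V.
  by apply: ge_ereal_sup => _ [n Vn <-] /=; rewrite lee_fin lerN2 sf.
by rewrite lte_fin oppr_lt0.
Qed.

Definition chaotic_point delta x :=
  dist_cvg d (fun n => iter n T x) x0 /\
  (delta%:E <= upper_density R [set n | (delta < d (iter n T x) x0)%R])%E.

(** A positive limit inferior along [B] is a uniform lower bound on all but
    finitely many elements of [B]; one [delta], small enough, serves both as
    this bound and as the density of [B].  The other direction takes for [B]
    the set of times at which the orbit is [delta]-far. *)
Lemma dist_semi_irregular2P x : dist_semi_irregular2 d T x0 x <->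
  exists2 delta, 0 < delta & chaotic_point delta x.
Proof.
split.
  move=> [[A [A1 Ax]] [B [B0 /limf_einf_gt0[s s0 [V [M _ MV] sV]]]]].
  have [c c0 cB] : exists2 c, 0 < c & (c%:E <= upper_density R B)%E.
    have := upper_density_le1 R B; move: B0.
    by case: (upper_density R B) => // r r0 _; exists r.
  exists (Num.min (s / 2) c); first by rewrite lt_min c0 divr_gt0.
  split.
    move=> e e0; apply/eqP; rewrite eq_le upper_density_le1 /=.
    have [N _ NA] := Ax _ (nbhs_metric_ball dcompat x0 e0).
    by apply: (upper_density_ge_eventually (A := A) (N := N) NA); rewrite A1.
  apply: (upper_density_ge_eventually (A := B) (N := M)).
    move=> n Mn Bn /=; rewrite gt_min; apply/orP; left.
    by apply: lt_le_trans (sV _ (MV _ Mn Bn)); lra.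
  by apply: le_trans cB; rewrite lee_fin ge_min lexx orbT.
move=> [delta delta0 [xprox xfar]]; split.
  by have [N [_ _ ]] := dist_cvg_realized dcompat xprox.
exists [set n | delta < d (iter n T x) x0]; split.
  exact: lt_le_trans xfar.
apply/limf_einf_gt0; exists delta => //.
by exists [set n | delta < d (iter n T x) x0]; [exists 0%N|move=> n /ltW].
Qed.

Lemma orbit_open n (U : set X) : continuous T -> open U ->
  open [set x | U (iter n T x)].
Proof.
move=> Tcont; elim: n U => //= n IH U oU.
apply: (IH (T @^-1` U)); exact: open_comp.
Qed.

(** Finitely many of the open conditions [O k] matter, and those that hold at
    [x] persist near [x]; the count is therefore lower semicontinuous. *)
Lemma open_count (O : nat -> set X) n (c : R) : (forall k, open (O k)) ->
  open [set x | c < (count_upto [set k | O k x] n)%:R].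
Proof.
move=> oO; rewrite openE => x /= cx; rewrite /interior.
have : nbhs x [set y | forall k, (k <= n)%N -> O k x -> O k y].
  elim: (n) => [|m IH].
    have [Ox|nOx] := pselect (O 0%N x).
      have : nbhs x (O 0%N) by exact: open_nbhs_nbhs.
      by apply: filterS => y Oy k; rewrite leqn0 => /eqP ->.
    by apply: nearW => y k; rewrite leqn0 => /eqP ->.
  have : nbhs x [set y | O m.+1 x -> O m.+1 y].
    have [Ox|nOx] := pselect (O m.+1 x).
      have : nbhs x (O m.+1) by exact: open_nbhs_nbhs.
      by apply: filterS => y Oy _.
    by apply: nearW => y /nOx.
  apply: filterS2 IH => y IH Om k; rewrite leq_eqVlt => /predU1P[->//|].
  exact: IH.
apply: filterS => y xy; apply: lt_le_trans cx _; rewrite ler_nat.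
by apply: sub_count_upto => k /andP[_ kn]; exact: xy.
Qed.

(** The index [i] serves at the same time as the precision [1 / (i + 1)], as
    the density error and as the lower bound on the time, so that a single
    sequence of open sets cuts out the chaotic points. *)
Definition chaotic_approx (delta : R) i : set X := [set x |
  (exists2 n, (i <= n)%N & (1 - i.+1%:R^-1) * n%:R <
     (count_upto [set k | d (iter k T x) x0 < i.+1%:R^-1] n)%:R :> R) /\
  (exists2 n, (i <= n)%N & (delta - i.+1%:R^-1) * n%:R <
     (count_upto [set k | (delta < d (iter k T x) x0)%R] n)%:R :> R)].

Lemma chaotic_approx_open delta i : continuous T ->
  open (chaotic_approx delta i).
Proof.
move=> Tcont; apply: openI.
  have -> : (fun x => exists2 n, (i <= n)%N & (1 - i.+1%:R^-1) * n%:R <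
     (count_upto [set k | d (iter k T x) x0 < i.+1%:R^-1] n)%:R :> R) =
     \bigcup_(n in [set n | (i <= n)%N]) [set x | (1 - i.+1%:R^-1) * n%:R <
     (count_upto [set k | d (iter k T x) x0 < i.+1%:R^-1] n)%:R :> R] by [].
  apply: bigcup_open => n _.
  apply: (@open_count (fun k => [set x | d (iter k T x) x0 < i.+1%:R^-1])) => k.
  apply: (@orbit_open k [set y | d y x0 < i.+1%:R^-1]) => //.
  exact: open_metric_lt.
have -> : (fun x => exists2 n, (i <= n)%N & (delta - i.+1%:R^-1) * n%:R <
   (count_upto [set k | delta < d (iter k T x) x0] n)%:R :> R) =
   \bigcup_(n in [set n | (i <= n)%N]) [set x | (delta - i.+1%:R^-1) * n%:R <
   (count_upto [set k | delta < d (iter k T x) x0] n)%:R :> R] by [].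
apply: bigcup_open => n _.
apply: (@open_count (fun k => [set x | delta < d (iter k T x) x0])) => k.
apply: (@orbit_open k [set y | delta < d y x0]) => //.
exact: open_metric_gt.
Qed.

Lemma chaotic_pointP delta x :
  chaotic_point delta x <-> forall i, chaotic_approx delta i x.
Proof.
have inv0 i : 0 < i.+1%:R^-1 :> R by rewrite invr_gt0 ltr0n.
have inv_le (e : R) N : 0 < e -> exists2 i, (N <= i)%N & i.+1%:R^-1 <= e.
  move=> e0; exists (maxn N (Num.truncn e^-1)); first exact: leq_maxl.
  rewrite invf_ple ?posrE ?ltr0n//.
  apply/ltW; apply: lt_le_trans (truncnS_gt _) _; rewrite ler_nat.
  by rewrite ltnS leq_maxr.
split=> [[xprox /upper_density_geP xfar] i|xi].
  split; last exact: xfar.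
  by have /upper_density1P := xprox _ (inv0 i); apply.
split.
  move=> e e0; apply/upper_density1P => e' e'0 N.
  have ee'0 : 0 < Num.min e e' by rewrite lt_min e0.
  have [i Ni] := inv_le _ N ee'0; rewrite le_min => /andP[ie ie'].
  have [[n iN cn] _] := xi i; exists n; first exact: leq_trans iN.
  apply: (@le_lt_trans _ _ ((1 - i.+1%:R^-1) * n%:R)).
    by rewrite ler_wpM2r ?ler0n// lerB.
  apply: lt_le_trans cn _; rewrite ler_nat; apply: sub_count_upto => k _ /=.
  by move=> /lt_le_trans; apply.
apply/upper_density_geP => e e0 N; have [i Ni ie] := inv_le _ N e0.
have [_ [n iN cn]] := xi i; exists n; first exact: leq_trans iN.
apply: le_lt_trans cn.
by rewrite ler_wpM2r ?ler0n// lerB.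
Qed.

End semi_irregular_points.

(** * The Baire category theorem *)

Section Baire.
Context {R : realType} {X : topologicalType}.

(** The usual nested balls, with centres kept in [H] so that the limit of the
    centres lies in [H]. *)
Lemma Baire_closed (H : set X) (V : nat -> set X) :
  completely_metrizable R X -> closed H -> H !=set0 ->
  (forall n, open (V n)) ->
  (forall n x U, H x -> nbhs x U -> exists y, [/\ H y, U y & V n y]) ->
  exists2 y, H y & forall n, V n y.
Proof.
move=> [d [dcompat dcomplete]] Hclosed [x0 Hx0] oV denseV.
have /choice[f Hf] : forall p : nat * (X * R), exists q : X * R,
    H p.2.1 -> 0 < p.2.2 -> [/\ H q.1, 0 < q.2, q.2 <= p.1.+1%:R^-1 &
    forall y, d y q.1 <= q.2 -> V p.1 y /\ d y p.2.1 < p.2.2].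
  move=> [n [x r]] /=; have [Hx|?] := pselect (H x); last by exists (x, r).
  have [r0|?] := pselect (0 < r); last by exists (x, r).
  have [y [Hy yxr Vy]] := denseV n x _ Hx (nbhs_metric_ball dcompat x r0).
  have : nbhs y (V n `&` [set z | d z x < r]).
    apply: filterI; apply: open_nbhs_nbhs; split => //.
    exact: open_metric_lt.
  move=> /(nbhs_metricP dcompat)[e e0 eV].
  have inv0 : 0 < n.+1%:R^-1 :> R by rewrite invr_gt0 ltr0n.
  (* Halving [e] puts the closed ball of the new radius inside the open ball. *)
  exists (y, Num.min (e / 2) n.+1%:R^-1) => _ _; split => //=.
  - by rewrite lt_min inv0 divr_gt0.
  - by rewrite ge_min lexx orbT.
  - move=> z; rewrite le_min => /andP[ze _]; apply: eV.
    by apply: le_lt_trans ze _; lra.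
pose fix s n := if n is m.+1 then f (m, s m) else (x0, 1).
have sH n : H (s n).1 /\ 0 < (s n).2.
  elim: n => [|n [Hn rn]]; first by split; rewrite /= ?ltr01.
  by have [] := Hf (n, s n) Hn rn.
have sS n : (s n.+1).2 <= n.+1%:R^-1 /\ forall y, d y (s n.+1).1 <= (s n.+1).2 ->
    V n y /\ d y (s n).1 < (s n).2.
  by have [Hn rn] := sH n; have [] := Hf (n, s n) Hn rn.
have nested n m : (n <= m)%N -> d (s m).1 (s n).1 <= (s n).2.
  move=> /subnK <-; move: (m - n)%N => k; elim: k n => [|k IH] n.
    by rewrite add0n (cmetric_xx dcompat) ltW// (sH n).2.
  by apply/ltW; apply: ((sS n).2 _ _).2; rewrite addSnnS; exact: IH.
have [|l sl] := dcomplete (fun n => (s n).1).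
  move=> e e0; exists (Num.truncn (e / 2)^-1).+1 => m n Nm Nn.
  set N := (Num.truncn (e / 2)^-1).+1 in Nm Nn.
  have rN : (s N).2 < e / 2.
    apply: le_lt_trans (sS _).1 _.
    by rewrite invf_plt ?posrE ?ltr0n ?divr_gt0// truncnS_gt.
  have := nested _ _ Nm; have := nested _ _ Nn.
  have := cmetric_triangle dcompat (s N).1 (s m).1 (s n).1.
  rewrite (cmetric_sym dcompat (s N).1); lra.
have ball_l n : d l (s n).1 <= (s n).2.
  apply/ler_addgt0Pr => e e0.
  have [M _ HM] := sl _ (nbhs_metric_ball dcompat l e0).
  have /= := HM (maxn M n) (leq_maxl _ _).
  have := nested n (maxn M n) (leq_maxr _ _).
  have := cmetric_triangle dcompat (s (maxn M n)).1 l (s n).1.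
  rewrite (cmetric_sym dcompat l (s (maxn M n)).1); lra.
exists l => [|n]; last exact: ((sS n).2 l (ball_l n.+1)).1.
apply: Hclosed => U /sl[M _ MU].
by exists (s M).1; split; [exact: (sH M).1|exact: (MU M (leqnn M))].
Qed.
End Baire.

(** * Endomorphisms and the group generated by an orbit *)

Section generated_subgroup.
Context {R : realType} {G : topologicalGroupType}.
Variables (d : G -> G -> R) (T : {multiplicative G -> G}).
Hypotheses (dcompat : compatible_metric d) (dinv : left_invariant d).
Hypothesis Tcont : continuous T.
Implicit Types x y z : G.

Lemma nbhs_mulg x y (U : set G) : nbhs (x * y)%g U ->
  exists V W, [/\ nbhs x V, nbhs y W &
    forall a b, V a -> W b -> U (a * b)%g].
Proof.
move=> /(@mulg_continuous G (x, y))[[V W] /= [xV yW] VWU].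
by exists V, W; split => // a b Va Wb; exact: (VWU (a, b)).
Qed.

Lemma nbhs_mulgl x y (U : set G) : nbhs (x * y)%g U ->
  nbhs y [set z | U (x * z)%g].
Proof.
move=> /nbhs_mulg[V [W [xV yW VWU]]]; apply: filterS yW => z Wz /=.
exact: VWU (nbhs_singleton xV) Wz.
Qed.

Lemma closure_subgroup (L : set G) : is_subgroup L -> is_subgroup (closure L).
Proof.
move=> [L1 LM LV]; split; first exact: subset_closure.
  move=> x y Lx Ly U /nbhs_mulg[V [W [/Lx[a [La Va]] /Ly[b [Lb Wb]] VWU]]].
  by exists (a * b)%g; split; [exact: LM|exact: VWU].
move=> x Lx U /invg_continuous/Lx[a [La Ua]].
by exists (a^-1)%g; split => //; exact: LV.
Qed.

Lemma multiplicative1 : T 1%g = 1%g.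
Proof. by apply: (mulgI (T 1%g)); rewrite -gmulfM !mulg1. Qed.

Lemma multiplicativeV x : T (x^-1)%g = ((T x)^-1)%g.
Proof. by apply/esym/mulg1_eq; rewrite -gmulfM mulgV multiplicative1. Qed.

Lemma iterM n x y : iter n T (x * y)%g = (iter n T x * iter n T y)%g.
Proof. by elim: n => //= n ->; rewrite gmulfM. Qed.

Lemma iter1 n : iter n T 1%g = 1%g.
Proof. by elim: n => //= n ->; rewrite multiplicative1. Qed.

Lemma iterV n x : iter n T (x^-1)%g = ((iter n T x)^-1)%g.
Proof. by elim: n => //= n ->; rewrite multiplicativeV. Qed.

Lemma dist_iter_mulVg n x y :
  d (iter n T x) (iter n T y) = d (iter n T (x^-1 * y)%g) 1%g.
Proof.
by rewrite (cmetric_sym dcompat) -(dinv _ _ (iter n T x)^-1%g) mulVg iterM iterV.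
Qed.

Lemma dist_iterV n x : d (iter n T (x^-1)%g) 1%g = d (iter n T x) 1%g.
Proof.
rewrite -(dinv _ _ (iter n T x)) iterV mulgV mulg1.
exact: cmetric_sym.
Qed.

(** The triangle inequality for [x y], [1] and [x], where [d (x y) x = d y 1]
    by left invariance. *)
Lemma dist_mulg_le x y : d y 1%g <= d x 1%g + d (x * y)%g 1%g.
Proof.
rewrite -(dinv y 1%g x) mulg1 (cmetric_sym dcompat x 1%g) addrC.
exact: cmetric_triangle.
Qed.

Lemma dist_delta_chaotic_pair2E delta x y :
  dist_delta_chaotic_pair2 d T delta x y <->
  chaotic_point d T 1%g delta (x^-1 * y)%g.
Proof.
have lt_eq e : [set n | d (iter n T x) (iter n T y) < e] =
    [set n | d (iter n T (x^-1 * y)%g) 1%g < e].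
  by apply/funext => n /=; rewrite dist_iter_mulVg.
have gt_eq : [set n | delta < d (iter n T x) (iter n T y)] =
    [set n | delta < d (iter n T (x^-1 * y)%g) 1%g].
  by apply/funext => n /=; rewrite dist_iter_mulVg.
rewrite /dist_delta_chaotic_pair2 /chaotic_point gt_eq.
split=> -[prox far]; split=> // e e0; [rewrite -lt_eq|rewrite lt_eq];
  exact: prox.
Qed.

Lemma chaotic_pointV delta x : chaotic_point d T 1%g delta x ->
  chaotic_point d T 1%g delta (x^-1)%g.
Proof.
move=> [prox far]; split=> [e e0|].
  rewrite (_ : [set _ | _] = [set n | d (iter n T x) 1%g < e]); first exact: prox.
  by apply/funext => n /=; rewrite dist_iterV.
rewrite (_ : [set _ | _] = [set n | delta < d (iter n T x) 1%g])//.
by apply/funext => n /=; rewrite dist_iterV.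
Qed.

Definition subgroup_generated (A : set G) : set G :=
  \bigcap_(S in [set S | is_subgroup S /\ A `<=` S]) S.

Lemma subgroup_generated_subgroup A : is_subgroup (subgroup_generated A).
Proof.
split; first by move=> S [[]].
  by move=> x y Lx Ly S SA; have [[_ + _] _] := SA; apply; [exact: Lx|exact: Ly].
by move=> x Lx S SA; have [[_ _ +] _] := SA; apply; exact: Lx.
Qed.

Lemma sub_subgroup_generated A : A `<=` subgroup_generated A.
Proof. by move=> x Ax S [_]; exact. Qed.

Variables (u : G) (delta : R).
Hypothesis delta_gt0 : 0 < delta.
Hypothesis u_chaotic : chaotic_point d T 1%g delta u.

Definition orbit_group := subgroup_generated [set iter m T u | m in setT].

Lemma orbit_group_iter m : orbit_group (iter m T u).
Proof. by apply: sub_subgroup_generated; exists m. Qed.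

Lemma orbit_group_invariant x : orbit_group x -> orbit_group (T x).
Proof.
move=> Lx.
have [L1 LM LV] := subgroup_generated_subgroup [set iter m T u | m in setT].
apply: (Lx (T @^-1` orbit_group)); split=> /=; last first.
  by move=> _ [m _ <-]; exact: (orbit_group_iter m.+1).
split=> /=.
- by rewrite multiplicative1.
- by move=> a b La Lb; rewrite gmulfM; exact: LM.
- by move=> a La; rewrite multiplicativeV; exact: LV.
Qed.

(** The points whose orbit tends to the identity along the density filter form
    a subgroup, and this subgroup contains the orbit of [u] because the filter
    is invariant under shifts. *)
Lemma orbit_group_dist_cvg x : orbit_group x ->
  dist_cvg d (fun n => iter n T x) 1%g.
Proof.
have [N [jN uN _]] := dist_cvg_realized dcompat u_chaotic.1.
move=> Lx; apply: (density_filter_dist_cvg dcompat jN).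
have FF := @density_filter_filter R N.
apply: (Lx [set x | iter n T x @[n --> density_filter R N] --> (1%g : G)]).
split; first split=> /=.
- rewrite (_ : (fun n => _) = cst 1%g); first exact: cvg_cst.
  by apply/funext => n; rewrite iter1.
- move=> a b aN bN U; rewrite -{1}(mulg1 1%g).
  move=> /nbhs_mulg[V [W [/aN FV /bN FW VWU]]].
  apply: (@filterS2 _ _ FF _ _ _ _ FV FW) => n Va Wb /=; rewrite iterM.
  exact: VWU.
- move=> a aN U; rewrite -{1}invg1 => /invg_continuous/aN.
  by apply: (@filterS _ _ FF) => n /=; rewrite iterV.
- move=> _ [m _ <-] U /uN/(density_filter_shift m jN).
  by apply: (@filterS _ _ FF) => n /=; rewrite iterD.
Qed.

(** If [T^(n + m) u] is [delta]-far from the identity, then [T^n x] or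
    [T^n (x T^m u)] is [delta / 2]-far, so one of these two sets of times has
    upper density at least [delta / 2].  Choosing [m] with [T^m u] close to the
    identity keeps both candidates near [x]. *)
Lemma orbit_group_chaotic_dense x U : orbit_group x -> nbhs x U ->
  exists y, [/\ orbit_group y, U y & chaotic_point d T 1%g (delta / 2) y].
Proof.
move=> Lx; rewrite -{1}(mulg1 x) => /nbhs_mulgl xU.
have [e e0 eU] := nbhs_metricP dcompat xU.
have [m um] : exists m, d (iter m T u) 1%g < e.
  apply: (@upper_density_gt0_nonempty R _ 1 ltr01).
  by rewrite (u_chaotic.1 _ e0).
have := upper_density_ge_shift m u_chaotic.2.
set A := [set n | delta / 2 < d (iter n T x) 1%g].
set B := [set n | delta / 2 < d (iter n T (x * iter m T u)%g) 1%g].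
move=> /(@upper_density_ge_half _ A B) => -[].
- move=> n /=; rewrite iterD => far.
  have := dist_mulg_le (iter n T x) (iter n T (iter m T u)).
  rewrite -iterM /A /B /= => le2.
  have [?|?] := ltP (delta / 2) (d (iter n T x) 1%g); first by left.
  by right; lra.
- move=> xA; exists x; split => //.
    by rewrite -(mulg1 x); apply: eU; rewrite (cmetric_xx dcompat).
  by split => //; exact: orbit_group_dist_cvg.
- move=> xB; exists (x * iter m T u)%g.
  have Lxu : orbit_group (x * iter m T u)%g.
    have [_ + _] := subgroup_generated_subgroup [set iter m T u | m in setT].
    by apply; [|exact: orbit_group_iter].
  split=> //; first exact: eU.
  by split => //; exact: orbit_group_dist_cvg.
Qed.

Lemma closure_orbit_group_invariant :
  invariant_set T (closure orbit_group).
Proof.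
move=> _ [x Lx <-] U /Tcont/Lx[a [La Ua]].
by exists (T a); split => //; exact: orbit_group_invariant.
Qed.

Lemma chaotic_point_neq1 e : 0 < e -> ~ chaotic_point d T 1%g e 1%g.
Proof.
move=> e0 [_ /(upper_density_gt0_nonempty e0)[n /=]].
by rewrite iter1 (cmetric_xx dcompat) ltNge ltW.
Qed.

(** Left translation by [f i] maps the closure of the orbit group onto itself,
    so the [y] with [(f i)^-1 y] chaotic form a countable intersection of
    open sets that are dense in it, and the Baire category theorem applies to
    all [i] at once. *)
Lemma extend_chaotic_family (f : nat -> G) : completely_metrizable R G ->
  (forall i, closure orbit_group (f i)) ->
  exists2 y, closure orbit_group y &
    forall i, chaotic_point d T 1%g (delta / 2) ((f i)^-1 * y)%g.
Proof.
move=> Gcm Hf.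
have subL := subgroup_generated_subgroup [set iter m T u | m in setT].
have [H1 HM HV] := closure_subgroup subL.
pose W i j := [set y | chaotic_approx d T 1%g (delta / 2) j ((f i)^-1 * y)%g].
(* Enumerate the pairs [(i, j)]; the integers that code no pair impose nothing. *)
pose V n := if unpickle n is Some (i, j) then W i j else setT.
have [||n|n x U Hx xU|y Hy Vy] := @Baire_closed R G (closure orbit_group) V Gcm.
- exact: closed_closure.
- by exists 1%g.
- rewrite /V; case: (unpickle n) => [[i j]|]; last exact: openT.
  apply: (@open_comp _ _ ( *%g ((f i)^-1)%g)); last exact: chaotic_approx_open.
  by move=> y _; exact: nbhs_mulgl.
- rewrite /V; case: (unpickle n) => [[i j]|]; last first.
    by exists x; split => //; exact: nbhs_singleton.
  have : nbhs ((f i)^-1 * x)%g [set z | U (f i * z)%g].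
    by apply: nbhs_mulgl; rewrite mulgA mulgV mul1g.
  move=> /nbhs_interior/(HM _ _ (HV _ (Hf i)) Hx)[z [Lz zU]].
  have [y [Ly yU yc]] := orbit_group_chaotic_dense Lz zU.
  exists (f i * y)%g; split => //.
    by apply: HM => //; exact: subset_closure.
  by rewrite /W /= mulgA mulVg mul1g; have /chaotic_pointP := yc; apply.
exists y => // i; apply/chaotic_pointP => j.
by have := Vy (pickle (i, j)); rewrite /V pickleK.
Qed.

(** A maximal set whose distinct points have chaotic quotients is uncountable:
    a countable one could be extended by a further point, which is new because
    the identity is not chaotic. *)
Lemma chaotic_point_dist_chaotic2 : completely_metrizable R G ->
  dist_chaotic2 d T.
Proof.
move=> Gcm; have delta20 : 0 < delta / 2 by rewrite divr_gt0.
pose P (K : set G) := K `<=` closure orbit_group /\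
  forall x y, K x -> K y -> x <> y ->
    chaotic_point d T 1%g (delta / 2) (x^-1 * y)%g.
have [F FP Ftot|K [[KH Kchaotic] Kmax]] := @Zorn_bigcup _ P.
  split=> [x [A /FP[AH _]]|x y [A FA Ax] [B FB By] xy]; first exact: AH.
  have [AB|BA] := Ftot A B FA FB.
    by apply: (FP B FB).2 => //; exact: AB.
  by apply: (FP A FA).2 => //; exact: BA.
exists K; split; last first.
  move=> x y Kx Ky xy; exists (delta / 2) => //.
  by apply/dist_delta_chaotic_pair2E; exact: Kchaotic.
move=> Kcount.
(* Points to be avoided; for an empty [K] a constant sequence does. *)
have [f [fH Kf]] : exists f : nat -> G,
    (forall i, closure orbit_group (f i)) /\ K `<=` range f.
  have [K0|[f]] := pfcard_geP Kcount.
    exists (fun=> 1%g); split; last by rewrite K0.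
    move=> _; apply: subset_closure.
    by have [] := subgroup_generated_subgroup [set iter m T u | m in setT].
  exists f; split=> [i|x /(@surj _ _ _ _ f)[n _ <-]]; last by exists n.
  exact/KH/funS.
have [y Hy ychaotic] := extend_chaotic_family Gcm fH.
have fresh k : K k -> chaotic_point d T 1%g (delta / 2) (k^-1 * y)%g.
  by move=> /Kf[n _ <-].
apply: (Kmax (K `|` [set y])).
  split; first exact: subsetUl.
  move=> Ky; have := fresh y (Ky y (or_intror erefl)); rewrite mulVg.
  exact: chaotic_point_neq1.
split=> [x [/KH//|->//]|x z [Kx|->] [Kz|->] xz].
- exact: Kchaotic.
- exact: fresh.
(* The quotient [y^-1 x] is the inverse of [x^-1 y]. *)
- rewrite -[X in chaotic_point _ _ _ _ X]invgK; apply: chaotic_pointV.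
  by rewrite invgM invgK; exact: fresh.
- by case: xz.
Qed.

End generated_subgroup.

(** * Restriction to a subgroup *)

Section restriction.
Context {R : realType}.

Lemma nbhs_set_typeP (X : topologicalType) (H : set X) (x : H) (U : set H) :
  nbhs x U <-> exists2 V, nbhs (set_val x) V & set_val @^-1` V `<=` U.
Proof.
split.
  move=> [_ /= [[W oW <-] Wx WU]]; exists W => //; exact: open_nbhs_nbhs.
move=> [V /(@initial_continuous H X set_val x) xV VU].
by apply: (filterS VU); exact: xV.
Qed.

Lemma restrict_metric_compatible (G : topologicalGroupType)
    (d : G -> G -> R) (H : set G) : compatible_metric d ->
  compatible_metric (restrict_metric d : H -> H -> R).
Proof.
move=> [[d0 dC dT] dN]; split.
  split=> [x y|x y|x y z]; rewrite /restrict_metric //.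
  split=> [/d0/val_inj//|->]; exact/d0.
move=> x U; split.
  move=> /nbhs_set_typeP[V /dN[e e0 eV] VU]; exists e => // y xy.
  exact/VU/eV.
move=> [e e0 eU]; apply/nbhs_set_typeP; exists [set y | d (set_val x) y < e].
  by apply/dN; exists e.
by move=> y; exact: eU.
Qed.

Lemma iter_restrict_map (G : groupType) (H : set G) (T : G -> G)
  (TH : invariant_set T H) n x :
  set_val (iter n (restrict_map TH) x) = iter n T (set_val x).
Proof. by elim: n => //= n <-. Qed.

(** Semi-irregularity is expressed by the distances of the orbit to the
    identity, and the restricted system has the same distances. *)
Lemma dist_semi_irregular2_restrict (G : topologicalGroupType)
    (d : G -> G -> R) (T : G -> G) (H : set G) (sH : is_subgroup H)
    (TH : invariant_set T H) (x : H) : compatible_metric d ->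
  dist_semi_irregular2 (restrict_metric d) (restrict_map TH) (sub_one sH) x <->
  dist_semi_irregular2 d T 1%g (set_val x).
Proof.
move=> dcompat; have rcompat := @restrict_metric_compatible _ d H dcompat.
rewrite (dist_semi_irregular2P _ _ dcompat) (dist_semi_irregular2P _ _ rcompat).
have dE n : restrict_metric d (iter n (restrict_map TH) x) (sub_one sH) =
    d (iter n T (set_val x)) 1%g.
  by rewrite /restrict_metric iter_restrict_map.
suff cE delta : chaotic_point (restrict_metric d) (restrict_map TH)
    (sub_one sH) delta x <-> chaotic_point d T 1%g delta (set_val x).
  by split=> -[delta delta0 /cE]; exists delta.
rewrite /chaotic_point /dist_cvg.
have lt_eq e : [set n | restrict_metric d (iter n (restrict_map TH) x)
    (sub_one sH) < e] = [set n | d (iter n T (set_val x)) 1%g < e].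
  by apply/funext => n /=; rewrite dE.
have -> : [set n | delta < restrict_metric d (iter n (restrict_map TH) x)
    (sub_one sH)] = [set n | delta < d (iter n T (set_val x)) 1%g].
  by apply/funext => n /=; rewrite dE.
split=> -[prox far]; split=> // e e0; [rewrite -lt_eq|rewrite lt_eq];
  exact: prox.
Qed.
End restriction.

(** * The equivalences *)

Theorem theorem5p19 (R : realType) (G : topologicalGroupType)
    (d : G -> G -> R) (T : {multiplicative G -> G})
    (G_cmetrizable : completely_metrizable R G)
    (d_compatible : compatible_metric d)
    (d_invariant : left_invariant d)
    (T_continuous : continuous T) :
  [<-> exists x : G, dist_semi_irregular2 d T 1%g x;
       exists x y : G, dist_chaotic_pair2 d T x y;
       dist_chaotic2 d T;
       exists (H : set G) (sH : is_subgroup H) (TH : invariant_set T H),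
         closed H /\
         dense [set x : H |
           dist_semi_irregular2 (restrict_metric d) (restrict_map TH)
             (sub_one sH) x] ].
Proof.
tfae.
- move=> [x /(dist_semi_irregular2P _ _ d_compatible)[delta delta0 xc]].
  exists 1%g, x, delta => //; apply/dist_delta_chaotic_pair2E => //.
  by rewrite invg1 mul1g.
- move=> [x [y [delta delta0 /dist_delta_chaotic_pair2E xy]]].
  apply: (chaotic_point_dist_chaotic2 d_compatible d_invariant T_continuous
    delta0) => //.
  exact: xy.
- move=> [K [Kunc Kchaotic]].
  have [x [y [Kx Ky xy]]] : exists x y, [/\ K x, K y & x <> y].
    apply: contrapT => noxy; apply: Kunc.
    have [[x Kx]|/set0P/negP/negbNE/eqP ->] := pselect (K !=set0); last first.
      exact: countable0.
    apply: sub_countable (countable1 x); apply: subset_card_le => y Ky.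
    by apply: contrapT => yx; apply: noxy; exists y, x.
  have [delta delta0 /dist_delta_chaotic_pair2E] := Kchaotic x y Kx Ky xy.
  move=> /(_ d_compatible d_invariant); set u := (x^-1 * y)%g => uc.
  pose L := orbit_group T u.
  have sL : is_subgroup L by exact: subgroup_generated_subgroup.
  exists (closure L), (closure_subgroup sL).
  exists (closure_orbit_group_invariant T_continuous (u := u)).
  split; first exact: closed_closure.
  move=> O [x0 Ox0] oO.
  have /nbhs_set_typeP[V xV VO] : nbhs x0 O by exact: open_nbhs_nbhs.
  have Hx0 : closure L (set_val x0) by exact: set_valP.
  have [a [La Va]] := Hx0 _ (nbhs_interior xV).
  have [b [Lb Vb bc]] :=
    orbit_group_chaotic_dense d_compatible d_invariant uc La Va.
  exists (SigSub (mem_set (subset_closure Lb))); split; first exact: VO.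
  apply/(dist_semi_irregular2_restrict _ _ _ d_compatible).
  apply/(dist_semi_irregular2P _ _ d_compatible); exists (delta / 2) => //.
  by rewrite divr_gt0.
- move=> [H [sH [TH [_ Hdense]]]].
  have [|x [_ Hx]] := Hdense setT _ openT; first by exists (sub_one sH).
  by exists (set_val x); apply/(dist_semi_irregular2_restrict sH TH).
Qed.
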